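(* The numbers $x'_B,x'_C,x'_D,x'_E,x'_F$ are algebraic, with minimal polynomials $P_{x_B}=-17372788157292129 + 85946816541669534 x^2 - 172967171143553289 x^4 + 125428630440736260 x^6 - 35361034276033728 x^8 + 4402034757921792 x^{10} - 436015591392256 x^{12} + 77220067192832 x^{14} - 11054716223488 x^{16} + 874491412480 x^{18} - 34734080000 x^{20} + 557842432 x^{22}$, $P_{x_C}=-55268097000787592100 + 83653148035178006805 x^2 - 49933201015710366166 x^4 + 15170804748275250138 x^6 - 2623723693990622868 x^8 + 292733387369474292 x^{10} - 24051159678783648 x^{12} + 1563610131071808 x^{14} - 77064294460416 x^{16} + 2572257472512 x^{18} - 50083921920 x^{20} + 427098112 x^{22}$, $P_{x_D}=-15937557042969 + 69169635141939 x^2 - 133600085051911 x^4 + 150590940104181 x^6 - 109441808559384 x^8 + 53597367271968 x^{10} - 17996039805696 x^{12} + 4144963934208 x^{14} - 647005151232 x^{16} + 66726690816 x^{18} - 4293132288 x^{20} + 139460608 x^{22}$, $P_{x_E}=-30534686672400 + 184473995962680 x^2 - 493600710483009 x^4 + 800738068318020 x^6 - 883225203916608 x^8 + 687262746783744 x^{10} - 378024688788480 x^{12} + 145061641105408 x^{14} - 37695035736064 x^{16} + 6218402758656 x^{18} - 582162055168 x^{20} + 27334279168 x^{22}$, $P_{x_F}=-622521 + 20028276 x^2 - 150285424 x^4 - 349270464 x^6 + 7694997504 x^8 - 5213620224 x^{10} - 109200064512 x^{12} + 709185896448 x^{14} - 1112735219712 x^{16} + 387346071552 x^{18} + 124822487040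 x^{20} + 8925478912 x^{22}$ respectively (each vanishes at the corresponding number and is irreducible over $\mathbb Q$).
   Context: Consider real numbers $t,T$ and points $A=(0,0)$, $B=(t,T)$, $C=(2t,0)$ and $P=(x_P,y_P)$ for $P\in\{D,E,F,G,H,J\}$ satisfying the system $t^2+T^2=1$; $-t(x_D-2t)+T y_D=\tfrac32$; $(x_D-2t)^2+y_D^2=9$; $t(x_E-t)-T(y_E-T)+1=0$; $(x_E-t)^2+(y_E-T)^2=4$; $x_F^2+y_F^2=1$; $|E-F|^2=1$; $|F-G|^2=1$; $|D-G|^2=4$; $|D-H|^2=4$; $|G-H|^2=4$; $|F-J|^2=1$; $|G-J|^2=1$; $x_H=x_J$. Fix the real solution with $t\approx0.992685948824186$, $T\approx0.120725337054926$, $D\approx(0.809996600722107,\,2.760161754567202)$, $E\approx(0.209102417540010,\,1.960833173433061)$, $F\approx(-0.061398137844065,\,0.998113354619244)$, $G\approx(-0.838419516770942,\,1.627587561152422)$, $H\approx(-0.995049481192288,\,3.621444891616507)$, $J\approx(-0.995049481192288,\,0.639930204451542)$. These points are the essential vertices of one quarter of the Harborth graph, whose center of symmetry is $K=(x_J,0)$. In the coordinate system centered at $K$ with axes the symmetry axes, the $x$-coordinate of a point $P$ is $x'_P=x_P-x_J$; here $x_B=t$, $x_C=2t$. *)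

(* Defs.v *)
From mathcomp Require Import all_boot all_order all_algebra.
From mathcomp Require Import reals.
From Stdlib Require Import ZArith.
From mathcomp.zify Require Import ssrZ.

Set Implicit Arguments.
Unset Strict Implicit.
Unset Printing Implicit Defensive.

Import Order.TTheory GRing.Theory Num.Theory.
Local Open Scope ring_scope.

(* Large literals are written in the binary type Z: numerals of ring_scope and
   int_scope are parsed through the unary type nat. *)

(* [:: c0; c1; c2; ...] denotes c0 + c1 X^2 + c2 X^4 + ... *)
Definition poly_in_X2 (c : seq Z) : {poly int} :=
  Poly [seq int_of_Z z | z <- c] \Po 'X^2.

Definition P_xB : {poly int} := poly_in_X2
  [:: (-17372788157292129)%Z;
      85946816541669534%Z;
      (-172967171143553289)%Z;
      125428630440736260%Z;
      (-35361034276033728)%Z;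
      4402034757921792%Z;
      (-436015591392256)%Z;
      77220067192832%Z;
      (-11054716223488)%Z;
      874491412480%Z;
      (-34734080000)%Z;
      557842432%Z].

Definition P_xC : {poly int} := poly_in_X2
  [:: (-55268097000787592100)%Z;
      83653148035178006805%Z;
      (-49933201015710366166)%Z;
      15170804748275250138%Z;
      (-2623723693990622868)%Z;
      292733387369474292%Z;
      (-24051159678783648)%Z;
      1563610131071808%Z;
      (-77064294460416)%Z;
      2572257472512%Z;
      (-50083921920)%Z;
      427098112%Z].

Definition P_xD : {poly int} := poly_in_X2
  [:: (-15937557042969)%Z;
      69169635141939%Z;
      (-133600085051911)%Z;
      150590940104181%Z;
      (-109441808559384)%Z;
      53597367271968%Z;
      (-17996039805696)%Z;
      4144963934208%Z;
      (-647005151232)%Z;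
      66726690816%Z;
      (-4293132288)%Z;
      139460608%Z].

Definition P_xE : {poly int} := poly_in_X2
  [:: (-30534686672400)%Z;
      184473995962680%Z;
      (-493600710483009)%Z;
      800738068318020%Z;
      (-883225203916608)%Z;
      687262746783744%Z;
      (-378024688788480)%Z;
      145061641105408%Z;
      (-37695035736064)%Z;
      6218402758656%Z;
      (-582162055168)%Z;
      27334279168%Z].

Definition P_xF : {poly int} := poly_in_X2
  [:: (-622521)%Z;
      20028276%Z;
      (-150285424)%Z;
      (-349270464)%Z;
      7694997504%Z;
      (-5213620224)%Z;
      (-109200064512)%Z;
      709185896448%Z;
      (-1112735219712)%Z;
      387346071552%Z;
      124822487040%Z;
      8925478912%Z].

(* Minimal polynomials are normalised to have integer coefficients instead of
   being monic; irreducibility is over the rationals. *)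
Definition is_minpoly (R : realType) (p : {poly int}) (x : R) : Prop :=
  root (map_poly (intr : int -> R) p) x /\
  irreducible_poly (map_poly (intr : int -> rat) p).

Definition sqdist (R : realType) (P Q : R * R) : R :=
  (P.1 - Q.1) ^+ 2 + (P.2 - Q.2) ^+ 2.

Definition harborth_system (R : realType) (t T : R) (D E F G H J : R * R) :
    Prop :=
  t ^+ 2 + T ^+ 2 = 1 /\
  - t * (D.1 - 2 * t) + T * D.2 = 3 / 2 /\
  (D.1 - 2 * t) ^+ 2 + D.2 ^+ 2 = 9 /\
  t * (E.1 - t) - T * (E.2 - T) + 1 = 0 /\
  (E.1 - t) ^+ 2 + (E.2 - T) ^+ 2 = 4 /\
  F.1 ^+ 2 + F.2 ^+ 2 = 1 /\
  sqdist E F = 1 /\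
  sqdist F G = 1 /\
  sqdist D G = 4 /\
  sqdist D H = 4 /\
  sqdist G H = 4 /\
  sqdist F J = 1 /\
  sqdist G J = 1 /\
  H.1 = J.1.

(* x agrees with the decimal number n * 10^-15 up to one unit in the last of
   the fifteen decimals. *)
Definition approx15 (R : realType) (x : R) (n : Z) : Prop :=
  `|x - (int_of_Z n)%:~R / 10 ^+ 15| < 1 / 10 ^+ 15.

Definition harborth_approx (R : realType) (t T : R) (D E F G H J : R * R) :
    Prop :=
  approx15 t 992685948824186%Z /\
  approx15 T 120725337054926%Z /\
  approx15 D.1 809996600722107%Z /\
  approx15 D.2 2760161754567202%Z /\
  approx15 E.1 209102417540010%Z /\
  approx15 E.2 1960833173433061%Z /\
  approx15 F.1 (-61398137844065)%Z /\
  approx15 F.2 998113354619244%Z /\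
  approx15 G.1 (-838419516770942)%Z /\
  approx15 G.2 1627587561152422%Z /\
  approx15 H.1 (-995049481192288)%Z /\
  approx15 H.2 3621444891616507%Z /\
  approx15 J.1 (-995049481192288)%Z /\
  approx15 J.2 639930204451542%Z.

(* The x-coordinate of P in the system centred at K = (J.1, 0), whose axes are
   parallel to the original ones. *)
Definition x_centred (R : realType) (J P : R * R) : R := P.1 - J.1.

(* Main.v *)
Require Import Defs.
From mathcomp Require Import all_boot all_order all_algebra all_field.
From mathcomp Require Import reals.
From Stdlib Require Import ZArith.
From mathcomp.zify Require Import ssrZ.
From mathcomp Require Import zify ring lra.

Set Implicit Arguments.
Unset Strict Implicit.
Unset Printing Implicit Defensive.

Import Order.TTheory GRing.Theory Num.Theory.
Local Open Scope ring_scope.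

(** After dividing the ordinates by [sqrt 3] the system has rational coefficients, and eliminating
    the points that depend linearly on the others leaves five quadratic equations in five unknowns.
    These have at most one solution in a small box, because the difference of two solutions is
    annihilated by the Jacobian at their midpoint. For each of the five polynomials [P], a positive
    root [x] of [P] is located by the intermediate value theorem, and five explicit elements of the
    field [Q(x)] are verified to solve the equations and to lie in the box. By uniqueness they are
    the coordinates of the given solution, and [x] is the centred abscissa that belongs to [P].
    The polynomials are irreducible because they already are so modulo 17. *)

(** * Integer coefficient sequences *)

Definition zr (K : nzRingType) (c : Z) : K := (int_of_Z c)%:~R.

Lemma zrD (K : nzRingType) a b : zr K (a + b)%Z = zr K a + zr K b.
Proof. by rewrite -rmorphD -(rmorphD int_of_Z). Qed.

Lemma zrM (K : nzRingType) a b : zr K (a * b)%Z = zr K a * zr K b.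
Proof. by rewrite -rmorphM -(rmorphM int_of_Z). Qed.

Lemma zrN (K : nzRingType) a : zr K (- a)%Z = - zr K a.
Proof. by rewrite -rmorphN -(rmorphN int_of_Z). Qed.

Lemma zrB (K : nzRingType) a b : zr K (a - b)%Z = zr K a - zr K b.
Proof. by rewrite -zrN -zrD. Qed.

Lemma zr0 (K : nzRingType) : zr K 0 = 0.
Proof. by []. Qed.

Lemma zr_nat (K : nzRingType) n : zr K (Z.of_nat n) = n%:R.
Proof. by rewrite /zr; have -> : int_of_Z (Z.of_nat n) = n :> int by lia. Qed.

Lemma zr1 (K : nzRingType) : zr K 1 = 1.
Proof. by []. Qed.

Lemma zr_le (R : realDomainType) a b : (zr R a <= zr R b) = (a <=? b)%Z.
Proof. by rewrite ler_int; lia. Qed.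

Lemma zr_lt (R : realDomainType) a b : (zr R a < zr R b) = (a <? b)%Z.
Proof. by rewrite ltr_int; lia. Qed.

(** Polynomials are lists over [Z], constant term first, so that every certificate check is a closed
    computation. The same list is evaluated in real fields and in characteristic [p]. *)
Definition ev (K : comNzRingType) (s : seq Z) (x : K) : K :=
  foldr (fun c a => zr K c + x * a) 0 s.

Fixpoint lin_seq (a b : Z) (s t : seq Z) : seq Z :=
  match s, t with
  | [::], _ => [seq (b * d)%Z | d <- t]
  | _, [::] => [seq (a * c)%Z | c <- s]
  | c :: s', d :: t' => (a * c + b * d)%Z :: lin_seq a b s' t'
  end.

Definition scale_seq (a : Z) (s : seq Z) : seq Z := [seq (a * c)%Z | c <- s].

Definition mul_seq (s t : seq Z) : seq Z :=
  foldr (fun c a => lin_seq 1 1 (scale_seq c t) (0%Z :: a)) [::] s.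

Lemma ev_scale (K : comNzRingType) a s (x : K) :
  ev (scale_seq a s) x = zr K a * ev s x.
Proof.
elim: s => [|c s IH] /=; first by rewrite mulr0.
by rewrite IH zrM; ring.
Qed.

Lemma ev_lin (K : comNzRingType) a b s t (x : K) :
  ev (lin_seq a b s t) x = zr K a * ev s x + zr K b * ev t x.
Proof.
elim: s t => [|c s IH] [|d t] /=; rewrite ?mulr0 ?add0r ?addr0 //.
- by rewrite zrM -/(scale_seq b t) ev_scale; ring.
- by rewrite zrM -/(scale_seq a s) ev_scale; ring.
- by rewrite IH zrD !zrM; ring.
Qed.

Lemma ev_mul (K : comNzRingType) s t (x : K) : ev (mul_seq s t) x = ev s x * ev t x.
Proof.
elim: s => [|c s IH] /=; first by rewrite mul0r.
by rewrite ev_lin ev_scale /= IH zr0 zr1; ring.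
Qed.

Lemma ev_horner (K : comNzRingType) s (x : K) : ev s x = (Poly (map (zr K) s)).[x].
Proof. by rewrite horner_Poly; elim: s => //= c s ->; rewrite addrC mulrC. Qed.

Lemma ev_root_X2 (K : comNzRingType) c (x : K) :
  (map_poly intr (poly_in_X2 c)).[x] = ev c (x ^+ 2).
Proof.
rewrite /poly_in_X2 map_comp_poly map_polyXn horner_comp hornerXn ev_horner.
congr (_.[_]); rewrite /map_poly; apply/polyP => i.
have -> : Poly (map (zr K) c) = map_poly intr (Poly (map int_of_Z c)).
  apply/polyP=> j; rewrite coef_map /= !coef_Poly.
  have [lt|ge] := ltnP j (size c); last by rewrite !nth_default ?size_map.
  by rewrite !(nth_map 0%Z).
by [].
Qed.

Lemma ev_all0 (K : comNzRingType) s (x : K) : all (Z.eqb 0) s -> ev s x = 0.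
Proof.
elim: s => //= c s IH /andP [c0 /IH ->].
have -> : c = 0%Z by move: c0; case: (c).
by rewrite zr0 mulr0 addr0.
Qed.

(* Exact division by [q0 :: q] from the low-order end. *)
Fixpoint dvd_low (n : nat) (q0 : Z) (q s : seq Z) : bool :=
  match n with
  | 0 => all (Z.eqb 0) s
  | n'.+1 =>
    if s is s0 :: s' then
      let w := (s0 / q0)%Z in
      (w * q0 =? s0)%Z && dvd_low n' q0 q (lin_seq 1 (- w) s' q)
    else true
  end.

(** Each round writes the dividend as [w] times the divisor plus X times the next dividend, so
    vanishing at [x] propagates back from the zero remainder. *)
Lemma ev_dvd_low (K : comNzRingType) n q0 q s (x : K) :
  ev (q0 :: q) x = 0 -> dvd_low n q0 q s -> ev s x = 0.
Proof.
move=> q_x0; elim: n s => [|n IH] s /=; first exact: ev_all0.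
case: s => [|s0 s] // /andP [eq_s0 /IH].
have def_s0 : (s0 / q0 * q0)%Z = s0 by apply/Z.eqb_eq.
rewrite ev_lin zrN zr1 /= -{2}def_s0 zrM => /(congr1 ( *%R x)) e.
move: q_x0 => /= /(congr1 ( *%R (zr K (s0 / q0)%Z))) e'.
by rewrite -[RHS](addr0 0) -{1}(mulr0 x) -e -(mulr0 (zr K (s0 / q0)%Z)) -e'; ring.
Qed.

(* [b ^ size s * s(a / b)] together with [b ^ size s]. *)
Fixpoint hom_comp (s a b : seq Z) : seq Z * seq Z :=
  if s is c :: s' then
    let: (r, q) := hom_comp s' a b in
    let bq := mul_seq b q in
    (lin_seq 1 1 (scale_seq c bq) (mul_seq a r), bq)
  else ([::], [:: 1%Z]).

Lemma ev_hom_comp (K : comNzRingType) s a b (x w : K) :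
  ev a x = w * ev b x ->
  ev (hom_comp s a b).1 x = ev b x ^+ size s * ev s w.
Proof.
move=> def_w.
suff [-> _] : ev (hom_comp s a b).1 x = ev b x ^+ size s * ev s w
  /\ ev (hom_comp s a b).2 x = ev b x ^+ size s by [].
elim: s => [|c s]; first by rewrite /= zr1 !mulr0 addr0.
cbn [hom_comp]; case: (hom_comp s a b) => r q; cbn [fst snd] => -[r_x q_x].
rewrite ev_lin ev_scale !ev_mul r_x q_x def_w zr1 exprS.
by split; last by []; rewrite [ev (_ :: _) _]/=; ring.
Qed.

(** On [[0, 1]] all powers of the variable lie in [[0, 1]], so a polynomial is bounded below there
    by the sum of its negative coefficients. [pos_on01] sharpens this by keeping the constant term
    whole. *)
Definition neg_sum (s : seq Z) : Z := foldr (fun c a => (Z.min c 0 + a)%Z) 0%Z s.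

Definition pos_on01 (s : seq Z) : bool :=
  if s is c :: s' then (0 <? c + neg_sum s')%Z else false.

Lemma neg_sum_le_ev (R : realDomainType) s (y : R) :
  0 <= y <= 1 -> zr R (neg_sum s) <= ev s y.
Proof.
case/andP=> y0 y1; elim: s => [|c s IH] //=.
rewrite zrD; apply: lerD; first by rewrite zr_le; lia.
have n0 : zr R (neg_sum s) <= 0.
  by rewrite -(zr0 R) zr_le; elim: (s) => //= d u; lia.
have [e0|/ltW e0] := leP 0 (ev s y); first by rewrite (le_trans n0) ?mulr_ge0.
by apply: le_trans IH _; rewrite -[leLHS]mul1r; apply: ler_wnM2r.
Qed.

Lemma pos_on01P (R : realDomainType) s (y : R) :
  0 <= y <= 1 -> pos_on01 s -> 0 < ev s y.
Proof.
move=> y01; case: s => [|c s] //= cpos.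
have y0 : 0 <= y by case/andP: y01.
have y1 : y <= 1 by case/andP: y01.
have := @neg_sum_le_ev R s y y01; move: cpos; rewrite -(zr_lt R) zrD zr0.
have n0 : zr R (neg_sum s) <= 0.
  by rewrite -(zr0 R) zr_le; elim: (s) => //= d u; lia.
nra.
Qed.

(** * Irreducibility from a reduction modulo a prime *)

(** Take a root [z] of [f] modulo [p] in a splitting field over the prime field. The field generated
    by [z] has [p ^ d] elements, where [d] is the degree of the minimal polynomial of [z], so
    Fermat's little theorem applies to it. *)
Lemma finite_field_root p (f : {poly int}) :
  prime p -> (1 < size f)%nat -> (lead_coef f)%:~R != 0 :> 'F_p ->
  exists (K : fieldType) (z : K) (d : nat),
    [/\ p%:R = 0 :> K, (0 < d < size f)%nat, z ^+ expn p d = z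
      & root (map_poly intr f) z].
Proof.
move=> p_pr sz_f lc_f; pose g : {poly 'F_p} := map_poly intr f.
have sz_g : size g = size f by apply: size_poly_eq; rewrite lead_coefE in lc_f.
have g0 : g != 0 by rewrite -size_poly_gt0 sz_g; apply: ltn_trans sz_f.
have [L [rs g_rs _]] := FinSplittingFieldFor g0.
have := eqp_size g_rs; rewrite size_map_poly size_prod_XsubC sz_g.
case: rs g_rs => [|z rs] g_rs; first by move=> e; rewrite e in sz_f.
move=> _; have gz : root (map_poly (in_alg L) g) z.
  by rewrite (eqp_root g_rs) root_prod_XsubC mem_head.
have map_g : map_poly (in_alg L) g = map_poly intr f :> {poly L}.
  by rewrite /g -map_poly_comp; apply: eq_map_poly => c; rewrite -[LHS]/(in_alg L c%:~R) rmorph_int.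
exists L, z, (\dim <<1%VS; z>>); split.
- by rewrite -(rmorph_nat (in_alg L)) pchar_Fp_0 // rmorph0.
- rewrite dim_Fadjoin dimv1 muln1 andTb -ltnS -size_minPoly.
  rewrite -sz_g -(size_map_poly (in_alg L) g) ltnS; apply: dvdp_leq.
    by rewrite map_poly_eq0.
  exact: minPoly_dvdp (alg_polyOver _ _) gz.
- have := Fermat's_little_theorem <<1%VS; z>>%AS z.
  by rewrite memv_adjoin card_Fp // => /esym/eqP.
- by rewrite -map_g.
Qed.

(** In a proper factorisation the factor of smaller degree has at most half the degree of [P]. Its
    leading coefficient divides that of [P] and so survives modulo [p]; hence it has a root modulo
    [p] of the excluded kind. *)
Lemma irreducible_mod_p p (P : {poly int}) :
  prime p -> (1 < size P)%nat -> (lead_coef P)%:~R != 0 :> 'F_p ->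
  (forall (K : fieldType) (z : K) (d : nat), p%:R = 0 :> K ->
     (0 < d)%nat -> (d.*2 < size P)%nat -> z ^+ expn p d = z ->
     ~~ root (map_poly intr P) z) ->
  irreducible_poly (map_poly intr P : {poly rat}).
Proof.
move=> p_pr sz_P lc_P no_root; split; first by rewrite size_rat_int_poly.
have no_factor (f g : {poly int}) : P = f * g -> (1 < size f)%nat ->
    (size f <= size g)%nat -> False.
  move=> def_P sz_f le_fg; move: lc_P; rewrite def_P lead_coefM intrM mulf_eq0.
  case/norP => lc_f _.
  have [K [z [d [p0 /andP [d0 ltd] zd fz]]]] := finite_field_root p_pr sz_f lc_f.
  have f0 : f != 0 by rewrite -size_poly_gt0; apply: ltn_trans sz_f.
  have g0 : g != 0 by rewrite -size_poly_gt0; apply: leq_trans le_fg; apply: ltn_trans sz_f.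
  have := no_root K z d p0 d0 _ zd; rewrite def_P rmorphM rootM fz => /(_ _)/negP; apply=> //.
  rewrite size_mul //; move: (size f) (size g) ltd le_fg sz_f => m n; lia.
(* Gauss's lemma: a rational divisor is a scalar multiple of an integral divisor with integral
   cofactor. *)
move=> q sz_q /dvdpP_rat_int [f [a a0 def_q] [g def_P]].
have P0 : P != 0 by rewrite -size_poly_gt0; apply: ltn_trans sz_P.
have [f0 g0] : f != 0 /\ g != 0.
  by apply/andP; rewrite -negb_or -mulf_eq0 -def_P.
have sz_f : (1 < size f)%nat.
  move: sz_q f0; rewrite def_q size_scale // size_rat_int_poly -size_poly_gt0.
  by case: (size f) => [|[]].
have [sz_g|sz_g] := leqP (size g) 1; last first.
  exfalso; have [le|lt] := leqP (size f) (size g); first exact: (no_factor f g).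
  by apply: (no_factor g f) (ltnW lt); rewrite // mulrC.
have [c c0 def_g] : exists2 c, c != 0 & g = c%:P.
  by exists g`_0; [rewrite -polyC_eq0 -size1_polyC|exact: size1_polyC].
rewrite def_q def_P def_g mulrC mul_polyC map_polyZ /=.
apply: eqp_trans (eqp_scale _ a0) _; rewrite eqp_sym; apply: eqp_scale.
by rewrite intr_eq0.
Qed.

(* Arithmetic in [(Z/p)[X]/(X^n + m)], where [n = size m]. *)
Definition red_top (m s : seq Z) : seq Z :=
  lin_seq 1 (- nth 0%Z s (size m)) (take (size m) s) m.

Definition mul_mod (p : Z) (m a b : seq Z) : seq Z :=
  foldr (fun c acc => [seq (x mod p)%Z | x <- red_top m (lin_seq 1 c (0%Z :: acc) b)])
    [::] a.

Fixpoint pow_mod (p : Z) (m a : seq Z) (e : positive) : seq Z :=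
  match e with
  | xH => a
  | xO e' => let r := pow_mod p m a e' in mul_mod p m r r
  | xI e' => let r := pow_mod p m a e' in mul_mod p m a (mul_mod p m r r)
  end.

(** If [h] stands for [X ^ (p ^ j)], this multiplies [acc] by the [X ^ (p ^ i) - X] with
    [j < i <= j + k]; each Frobenius power is obtained from the previous one. *)
Fixpoint frob_prod (p : nat) (m h acc : seq Z) (k : nat) : seq Z :=
  if k is k'.+1 then
    let h' := pow_mod (Z.of_nat p) m h (Pos.of_nat p) in
    frob_prod p m h'
      (mul_mod (Z.of_nat p) m acc (lin_seq 1 (-1) h' [:: 0%Z; 1%Z])) k'
  else acc.

Lemma size_lin a b s t : size (lin_seq a b s t) = maxn (size s) (size t).
Proof.
elim: s t => [|c s IH] [|d t] /=; rewrite ?size_map ?maxn0 ?max0n //.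
by rewrite IH maxnSS.
Qed.

Lemma size_mul_mod p m a b : (size (mul_mod p m a b) <= size m)%nat.
Proof.
case: a => //= c a; rewrite size_map size_lin geq_max leqnn andbT.
by rewrite size_take; case: ltnP => //= /ltnW.
Qed.

Lemma size_pow_mod p m a e :
  (size a <= size m)%nat -> (size (pow_mod p m a e) <= size m)%nat.
Proof. by case: e => //= e sz_a; apply: size_mul_mod. Qed.

Lemma ev_cat (K : comNzRingType) s t (x : K) :
  ev (s ++ t) x = ev s x + x ^+ size s * ev t x.
Proof.
elim: s => [|c s IH] /=; first by rewrite add0r mul1r.
by rewrite IH exprS; ring.
Qed.

Lemma ev_red_top (K : comNzRingType) m s (z : K) :
  z ^+ size m + ev m z = 0 -> (size s <= (size m).+1)%nat ->
  ev (red_top m s) z = ev s z.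
Proof.
move=> mz sz_s; rewrite ev_lin -{3}(cat_take_drop (size m) s) ev_cat.
have [le|lt] := leqP (size s) (size m).
  by rewrite nth_default // drop_oversize //= zr1 zr0; ring.
have sz : size s = (size m).+1 by apply/anti_leq; rewrite sz_s lt.
have -> : drop (size m) s = [:: nth 0%Z s (size m)].
  by rewrite (drop_nth 0%Z) // drop_oversize // sz.
rewrite size_take lt /= zr1 zrN.
have -> : z ^+ size m = - ev m z by apply/eqP; rewrite -addr_eq0 mz.
by ring.
Qed.

Lemma zr_mod (K : nzRingType) p a : zr K p = 0 -> zr K (a mod p)%Z = zr K a.
Proof.
move=> p0; have {2}-> : a = (p * (a / p) + a mod p)%Z.
  by have [->|nz] := Z.eq_dec p 0; [rewrite Zmod_0_r; lia|exact: Z_div_mod_eq_full].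
by rewrite zrD zrM p0 mul0r add0r.
Qed.

Lemma ev_mod (K : comNzRingType) p s (z : K) :
  zr K p = 0 -> ev [seq (x mod p)%Z | x <- s] z = ev s z.
Proof. by move=> p0; elim: s => //= c s ->; rewrite zr_mod. Qed.

Lemma ev_mul_mod (K : comNzRingType) p m a b (z : K) :
  zr K p = 0 -> z ^+ size m + ev m z = 0 -> (size b <= size m)%nat ->
  ev (mul_mod p m a b) z = ev a z * ev b z.
Proof.
move=> p0 mz sz_b; elim: a => [|c a IH]; first by rewrite mul0r.
have -> : mul_mod p m (c :: a) b =
    [seq (x mod p)%Z | x <- red_top m (lin_seq 1 c (0%Z :: mul_mod p m a b) b)] by [].
rewrite ev_mod // ev_red_top //; last first.
  by rewrite size_lin /= geq_max ltnS size_mul_mod leqW.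
by rewrite ev_lin /= IH zr1 zr0; ring.
Qed.

Lemma ev_pow_mod (K : comNzRingType) p m a e (z : K) :
  zr K p = 0 -> z ^+ size m + ev m z = 0 -> (size a <= size m)%nat ->
  ev (pow_mod p m a e) z = ev a z ^+ Pos.to_nat e.
Proof.
move=> p0 mz sz_a; elim: e => [e IH|e IH|] /=; last by rewrite expr1.
- rewrite !ev_mul_mod ?size_mul_mod ?size_pow_mod // IH -exprD -exprS.
  by congr (_ ^+ _); lia.
- rewrite ev_mul_mod ?size_pow_mod // IH -exprD.
  by congr (_ ^+ _); lia.
Qed.

(** Invariant: either the accumulator already vanishes at [z], or the factor of index [d], which
    vanishes there, is still to come. *)
Lemma ev_frob_prod (K : comNzRingType) p m h acc k d j (z : K) :
  (0 < p)%nat -> p%:R = 0 :> K -> z ^+ size m + ev m z = 0 ->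
  (1 < size m)%nat -> (size h <= size m)%nat ->
  ev h z = z ^+ expn p j -> z ^+ expn p d = z ->
  ev acc z = 0 \/ (j < d <= j + k)%nat ->
  ev (frob_prod p m h acc k) z = 0.
Proof.
move=> p_gt0 p0 mz m_gt1 sz_h hz dz.
have p0Z : zr K (Z.of_nat p) = 0 by rewrite zr_nat.
elim: k j h acc sz_h hz => [|k IH] j h acc sz_h hz acc0.
  by case: acc0 => //; rewrite addn0; case/andP => /leq_trans H /H; rewrite ltnn.
rewrite [frob_prod _ _ _ _ _]/=.
set h' := pow_mod _ _ _ _.
have sz_h' : (size h' <= size m)%nat by apply: size_pow_mod.
have hz' : ev h' z = z ^+ expn p j.+1.
  rewrite ev_pow_mod // hz -exprM expnSr; congr (_ ^+ (_ * _)); lia.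
apply: (IH j.+1) => //.
rewrite ev_mul_mod ?size_lin ?geq_max ?sz_h' // ev_lin hz' /= zr0 zr1.
rewrite (zrN _ 1) zr1.
case: acc0 => [->|/andP [ltjd ledk]]; first by left; rewrite mul0r.
have [eq_d|ne_d] := eqVneq d j.+1; first by left; rewrite -eq_d dz; ring.
by right; rewrite ltn_neqAle eq_sym ne_d ltjd addSnnS.
Qed.

Lemma size_frob_prod p m h acc k :
  (size acc <= size m)%nat -> (size (frob_prod p m h acc k) <= size m)%nat.
Proof. by elim: k h acc => //= k IH h acc _; rewrite IH ?size_mul_mod. Qed.

Fixpoint spread (c : seq Z) : seq Z :=
  if c is a :: c' then [:: a, 0%Z & spread c'] else [::].

Lemma size_spread c : size (spread c) = (size c).*2.
Proof. by elim: c => //= a c ->; rewrite doubleS. Qed.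

Lemma ev_spread (K : comNzRingType) c (x : K) : ev (spread c) x = ev c (x ^+ 2).
Proof. by elim: c => //= a c ->; rewrite zr0; ring. Qed.

(* A factorisation of the polynomial [P] of degree [2 n] yields a root [z] of [P] with
   [z ^ (p ^ d) = z] for some [0 < d <= n], in a field of characteristic [p]. This is excluded as
   the product of the [X ^ (p ^ d) - X] is a unit modulo [p] and [P]: its power of exponent
   [p ^ (2 n) - 1] is computed to be [1]. *)
Definition irreducible_mod (p : nat) (c : seq Z) : bool :=
  let q := Z.of_nat p in
  let n := (size c).-1 in
  let l := last 0%Z c in
  let li := (l ^ (q - 2) mod q)%Z in
  let m := [seq (a * li mod q)%Z | a <- spread (take n c)] in
  let r := frob_prod p m [:: 0%Z; 1%Z] [:: 1%Z] n in
  [&& (0 < n)%nat, ((l * li) mod q =? 1)%Z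
    & all (Z.eqb 0) (lin_seq 1 (-1) (pow_mod q m r (Z.to_pos (q ^ Z.of_nat n.*2 - 1)))
                       [:: 1%Z])].

Lemma irreducible_poly_in_X2 (p : nat) (c : seq Z) :
  prime p -> irreducible_mod p c ->
  irreducible_poly (map_poly (intr : int -> rat) (poly_in_X2 c)).
Proof.
move=> p_pr /and3P []; set q := Z.of_nat p; set n := (size c).-1.
set l := last 0%Z c; set li := (l ^ _ mod q)%Z; set m := map _ _; set r := frob_prod _ _ _ _ _.
move=> n_gt0 /Z.eqb_eq l_li r1.
have p_gt0 := prime_gt0 p_pr.
have sz_c : size c = n.+1 by move: n_gt0; rewrite /n; case: (c).
have def_c : c = take n c ++ [:: l].
  rewrite -{1}(cat_take_drop n c) (drop_nth 0%Z) ?sz_c //.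
  by rewrite drop_oversize ?sz_c // /l -nth_last.
have sz_m : size m = n.*2 by rewrite size_map size_spread size_takel // sz_c.
have l_unit (K : nzRingType) : p%:R = 0 :> K -> zr K l * zr K li = 1.
  move=> p0; have q0 : zr K q = 0 by rewrite zr_nat.
  by rewrite -zrM -(zr_mod _ q0) l_li zr1.
have l_Fp : zr 'F_p l != 0.
  apply/eqP=> l0; have := l_unit 'F_p (pchar_Fp_0 p_pr).
  by rewrite l0 mul0r => /esym/eqP; rewrite oner_eq0.
have l0 : int_of_Z l != 0 by apply: contraNneq l_Fp => e; rewrite /zr e.
have PolyK_c : Poly (map int_of_Z c) = map int_of_Z c :> seq int.
  by apply: (@PolyK _ 0); rewrite -[0]/(int_of_Z 0) last_map.
have lc_P : lead_coef (poly_in_X2 c) = int_of_Z l.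
  rewrite /poly_in_X2 lead_coef_comp ?size_polyXn // lead_coefXn expr1n mulr1.
  by rewrite lead_coefE PolyK_c nth_last -[0]/(int_of_Z 0) last_map.
have sz_P : size (poly_in_X2 c) = n.*2.+1.
  rewrite -[LHS]prednK ?size_poly_gt0 -?lead_coef_eq0 ?lc_P //.
  by rewrite size_comp_poly size_polyXn PolyK_c size_map sz_c muln2.
apply: (irreducible_mod_p p_pr); first by rewrite sz_P ltnS double_gt0.
  by rewrite lc_P.
move=> K z d p0 d0; rewrite sz_P ltnS leq_double => le_dn zd.
apply/negP; rewrite /root ev_root_X2 => /eqP; rewrite def_c ev_cat /= mulr0 addr0.
rewrite -exprM mul2n size_takel ?sz_c // -ev_spread => Pz.
have q0 : zr K q = 0 by rewrite zr_nat.
have mz : z ^+ size m + ev m z = 0.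
  (* Modulo [p], [m] holds the lower coefficients of [P] made monic, since [li] inverts the leading
     coefficient. *)
  rewrite sz_m; have -> : ev m z = zr K li * ev (spread (take n c)) z.
    rewrite /m; elim: (spread _) => /= [|a s ->]; first by rewrite mulr0.
    by rewrite zr_mod // zrM; ring.
  rewrite -(mul1r (z ^+ _)) -(l_unit _ p0) -(mulr0 (zr K li)) -Pz.
  by ring.
have m_gt1 : (1 < size m)%nat by rewrite sz_m; case: (n) n_gt0.
have rz : ev r z = 0.
  apply: (@ev_frob_prod K p m _ _ n d 0 z) => //; last by right; rewrite d0.
  by rewrite expn0 /= zr0 zr1 mulr0 addr0 mulr1 add0r.
have sz_r : (size r <= size m)%nat by apply: size_frob_prod; apply: ltnW.
(* The computed power of [r] is 1 although [r] vanishes at [z]. The exponent must be seen to be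
   positive, because [0 ^+ 0] is 1. *)
have := ev_all0 z r1; rewrite ev_lin ev_pow_mod // rz expr0n.
have [e0|_] := eqVneq (Pos.to_nat _) 0%nat.
  by have := Pos2Nat.is_pos (Z.to_pos (q ^ Z.of_nat n.*2 - 1)); lia.
rewrite /= mulr0 (zrN _ 1) zr1 !mulr0 addr0 add0r mulr1 => /eqP.
by rewrite oppr_eq0 oner_eq0.
Qed.

(** * The reduced system *)

(* The unknowns are [t], [S = T / sqrt 3], [f = x_F], [h = y_F / sqrt 3] and [g = x_G]. The
   equilateral triangles DGH and FGJ turn [x_H = x_J] into [6 y_G = sqrt 3 (f + 3 h + 4 t)], which
   eliminates [y_G]; the equations are those for AB, AF, EF, FG and DG. *)
Definition reduced_system (R : comNzRingType) (t S f h g : R) : Prop :=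
  [/\ t ^+ 2 + 3 * S ^+ 2 = 1,
      f ^+ 2 + 3 * h ^+ 2 = 1,
      (3 * S - f) ^+ 2 + 3 * (2 * S + t - h) ^+ 2 = 1,
      12 * (f - g) ^+ 2 + (3 * h - f - 4 * t) ^+ 2 = 12
    & 3 * (t + 9 * S - 2 * g) ^+ 2 + (9 * S + 5 * t - f - 3 * h) ^+ 2 = 48].

Definition near (R : realFieldType) (c x : R) : Prop := `|x - c| <= 1 / 250.

(** The centres are coarse roundings of the given solution, with [T] and [y_F] divided by [sqrt 3].
    The common radius is small enough for the Jacobian argument below. *)
Definition near_root (R : realFieldType) (t S f h g : R) : Prop :=
  [/\ near (99 / 100) t, near (7 / 100) S, near (- (6 / 100)) f,
      near (15 / 26) h & near (- (84 / 100)) g].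

(** The midpoint is [c + e] with [e] at most 1/250 in absolute value. The products [e * d] can then
    serve as atoms of linear arithmetic, bounded by a multiple of the absolute value of [d]. *)
Lemma midpoint_near (R : realFieldType) (c x y : R) :
  near c x -> near c y ->
  exists2 e, x + y = 2 * (c + e) &
    forall d, - (`|d| / 250) <= e * d <= `|d| / 250.
Proof.
rewrite /near !ler_norml => nx ny; exists ((x + y) / 2 - c); first by field.
move=> d; rewrite -ler_norml normrM mulrC; apply: ler_wpM2l => //.
by rewrite ler_norml; lra.
Qed.

(* The difference of the two systems is linear in the difference of the solutions,
   with the Jacobian at their midpoint as matrix. *)
Lemma reduced_system_uniq (R : realFieldType) (t S f h g t' S' f' h' g' : R) :
  reduced_system t S f h g -> near_root t S f h g ->
  reduced_system t' S' f' h' g' -> near_root t' S' f' h' g' ->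
  [/\ t = t', S = S', f = f', h = h' & g = g'].
Proof.
case=> e1 e2 e3 e4 e5 [bt bS bf bh bg] [e1' e2' e3' e4' e5'] [bt' bS' bf' bh' bg'].
pose dt := t - t'; pose dS := S - S'; pose df := f - f'; pose dh := h - h'.
pose dg := g - g'.
have [et st nt] := midpoint_near bt bt'; have [eS sS nS] := midpoint_near bS bS'.
have [ef sf nf] := midpoint_near bf bf'; have [eh sh nh] := midpoint_near bh bh'.
have [eg sg ng] := midpoint_near bg bg'; clear bt bS bf bh bg bt' bS' bf' bh' bg'.
(* Subtracting corresponding equations and factoring each difference of squares gives five equations
   linear in the differences. *)
have q1 : (t + t') * dt + 3 * (S + S') * dS = 0.
  by have := congr2 (fun x y => x - y) e1 e1'; rewrite subrr /dt /dS => <-; ring.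
have q2 : (f + f') * df + 3 * (h + h') * dh = 0.
  by have := congr2 (fun x y => x - y) e2 e2'; rewrite subrr /df /dh => <-; ring.
have q3 : (3 * (S + S') - (f + f')) * (3 * dS - df)
   + 3 * (2 * (S + S') + (t + t') - (h + h')) * (2 * dS + dt - dh) = 0.
  by have := congr2 (fun x y => x - y) e3 e3'; rewrite subrr /dt /dS /df /dh => <-; ring.
have q4 : 12 * ((f + f') - (g + g')) * (df - dg)
   + (3 * (h + h') - (f + f') - 4 * (t + t')) * (3 * dh - df - 4 * dt) = 0.
  by have := congr2 (fun x y => x - y) e4 e4'; rewrite subrr /dt /dg /df /dh => <-; ring.
have q5 : 3 * ((t + t') + 9 * (S + S') - 2 * (g + g')) * (dt + 9 * dS - 2 * dg)
   + (9 * (S + S') + 5 * (t + t') - (f + f') - 3 * (h + h'))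
     * (9 * dS + 5 * dt - df - 3 * dh) = 0.
  by have := congr2 (fun x y => x - y) e5 e5'; rewrite subrr /dt /dS /dg /df /dh => <-; ring.
rewrite {}st {}sS {}sf {}sh {}sg in q1 q2 q3 q4 q5.
have zero (x y k : R) : `|x - y| <= k -> k <= 0 -> x = y.
  move=> le k0; apply/eqP; rewrite -subr_eq0 -normr_le0; exact: le_trans le k0.
clear e1 e2 e3 e4 e5 e1' e2' e3' e4' e5'.
have at0 := normr_ge0 dt; have aS0 := normr_ge0 dS; have af0 := normr_ge0 df.
have ah0 := normr_ge0 dh; have ag0 := normr_ge0 dg.
move: (nt dt) (nt dS) (nt df) (nt dh) (nt dg) => {nt} ntt ntS ntf nth ntg.
move: (nS dt) (nS dS) (nS df) (nS dh) (nS dg) => {nS} nSt nSS nSf nSh nSg.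
move: (nf dt) (nf dS) (nf df) (nf dh) (nf dg) => {nf} nft nfS nff nfh nfg.
move: (nh dt) (nh dS) (nh df) (nh dh) (nh dg) => {nh} nht nhS nhf nhh nhg.
move: (ng dt) (ng dS) (ng df) (ng dh) (ng dg) => {ng} ngt ngS ngf ngh ngg.
have abs250 (d : R) : exists2 p, `|d| / 250 = p & `|d| = 250 * p.
  by exists (`|d| / 250) => //; field.
have [pt Ept defpt] := abs250 dt; rewrite {}Ept in ntt nSt nft nht ngt.
have [pS EpS defpS] := abs250 dS; rewrite {}EpS in ntS nSS nfS nhS ngS.
have [pf Epf defpf] := abs250 df; rewrite {}Epf in ntf nSf nff nhf ngf.
have [ph Eph defph] := abs250 dh; rewrite {}Eph in nth nSh nfh nhh ngh.
have [pg Epg defpg] := abs250 dg; rewrite {}Epg in ntg nSg nfg nhg ngg.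
have pt0 : 0 <= pt by move: at0 defpt; clear; lra.
have pS0 : 0 <= pS by move: aS0 defpS; clear; lra.
have pf0 : 0 <= pf by move: af0 defpf; clear; lra.
have ph0 : 0 <= ph by move: ah0 defph; clear; lra.
have pg0 : 0 <= pg by move: ag0 defpg; clear; lra.
clear at0 aS0 af0 ah0 ag0 abs250.
(* [D] is the sum of the absolute differences divided by 250. Linear arithmetic then inverts the
   Jacobian at the centre, with the deviations as error terms, and bounds each difference by a
   multiple of [D]. *)
have [D defD] : exists D : R, D = pt + pS + pf + ph + pg by eexists.
have ct : `|dt| <= 25 * D by clear zero defpt defpS defpf defph defpg; rewrite ler_norml; lra.
have cS : `|dS| <= 25 * D by clear zero defpt defpS defpf defph defpg; rewrite ler_norml; lra.
have cf : `|df| <= 50 * D by clear zero defpt defpS defpf defph defpg; rewrite ler_norml; lra.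
have ch : `|dh| <= 25 * D by clear zero defpt defpS defpf defph defpg; rewrite ler_norml; lra.
have cg : `|dg| <= 60 * D by clear zero defpt defpS defpf defph defpg; rewrite ler_norml; lra.
(* Adding the five bounds gives [250 * D <= (25 + 25 + 50 + 25 + 60) * D = 185 * D]. *)
have D0 : D <= 0 by move: defD ct cS cf ch cg; rewrite defpt defpS defpf defph defpg; clear; lra.
by split; apply: zero; eassumption || (move: D0; clear; lra).
Qed.

(** * Algebraic solutions of the reduced system *)

(** Transports the cell [[a / B, (a + 1) / B]] to [[0, 1]] and clears denominators, so that
    [pos_on01] applies. *)
Definition on_cell (a B : Z) (s : seq Z) : seq Z :=
  (hom_comp s [:: a; 1%Z] [:: B]).1.

Lemma ev_on_cell (R : realFieldType) a B s (y : R) :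
  zr R B != 0 ->
  ev (on_cell a B s) y = zr R B ^+ size s * ev s ((zr R a + y) / zr R B).
Proof.
move=> B0; rewrite /on_cell (@ev_hom_comp _ _ _ _ _ ((zr R a + y) / zr R B)).
  by rewrite /= mulr0 addr0.
by rewrite /= zr1 !mulr0 !addr0 mulr1 divfK.
Qed.

Lemma pos_on_cell (R : realFieldType) a B s (y : R) :
  0 < zr R B -> 0 <= y <= 1 -> pos_on01 (on_cell a B s) ->
  0 < ev s ((zr R a + y) / zr R B).
Proof.
move=> B0 y01 /(pos_on01P y01); rewrite ev_on_cell ?(gt_eqF B0) //.
by rewrite pmulr_rgt0 // exprn_gt0.
Qed.

(** The two numbers tested are the values at 0 and at 1. *)
Definition changes_sign (s : seq Z) : bool :=
  (head 0 s <? 0)%Z && (0 <? foldr Z.add 0 s)%Z.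

Lemma root_on_cell (R : rcfType) a B s :
  0 < zr R B -> changes_sign (on_cell a B s) ->
  exists2 y : R, 0 <= y <= 1 & ev s ((zr R a + y) / zr R B) = 0.
Proof.
move=> B0 /andP [neg pos]; set h := on_cell a B s in neg pos.
have h0 : ev h (0 : R) = zr R (head 0%Z h) by case: (h) => //= c t; rewrite mul0r addr0.
have h1 : ev h (1 : R) = zr R (foldr Z.add 0%Z h).
  by elim: (h) => //= c t ->; rewrite zrD mul1r.
have [||y y01 hy] := @poly_ivt R (Poly (map (zr R) h)) 0 1; first exact: ler01.
  by rewrite -!ev_horner h0 h1 -(zr0 R) !zr_le; apply/andP; split; lia.
exists y => //; move: hy; rewrite /root -ev_horner /h ev_on_cell ?(gt_eqF B0) // mulf_eq0.
by rewrite expf_eq0 (gt_eqF B0) andbF => /eqP.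
Qed.

(* Let [c] be the coefficients of a polynomial in [x ^ 2] and [k] its derivative scaled by
   [cert_scale]. A certificate stands for the reduced solution with coordinates
   [x * N(x^2) / k(x^2)], where [x] is the positive root of [c] whose square lies in the cell
   [[cert_cell, cert_cell + 1] / cert_base] and [N] is one of the five numerators. The numerators
   come from integer relations found with LLL; the derivative as denominator keeps them small. *)
Record certificate := Certificate {
  cert_scale : Z; cert_cell : Z; cert_base : Z;
  num_t : seq Z; num_S : seq Z; num_f : seq Z; num_h : seq Z; num_g : seq Z }.

Fixpoint deriv_seq_from (i : Z) (s : seq Z) : seq Z :=
  if s is c :: s' then (i * c)%Z :: deriv_seq_from (i + 1) s' else [::].

Definition den_seq (C : certificate) (c : seq Z) : seq Z :=
  scale_seq (cert_scale C) (deriv_seq_from 1 (behead c)).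

(** With X for [x ^ 2], squaring [x * s / k] produces the extra factor X. The equation between
    coordinates becomes divisibility of [X * (a * s ^ 2 + b * t ^ 2) - d * k ^ 2] by [c]. For
    numerators of degree 10 this has 22 coefficients, whence the number of rounds. *)
Definition quad_check (c k : seq Z) (a b d : Z) (s t : seq Z) : bool :=
  dvd_low 22 (head 0%Z c) (behead c)
    (lin_seq 1 (- d) (0%Z :: lin_seq a b (mul_seq s s) (mul_seq t t))
       (mul_seq k k)).

(** A coordinate involves [x] itself, but its square involves only [x ^ 2]. Once its sign is known
    to be [sg], closeness to [sg * a / b] amounts to inequalities between squares, which are
    polynomial on the cell. *)
Definition near_check (cell : seq Z -> seq Z) (k : seq Z) (sg a b : Z) (s : seq Z) :
    bool :=
  let s2 := 0%Z :: mul_seq s s in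
  let k2 := mul_seq k k in
  let lo := (250 * a - b)%Z in
  let hi := (250 * a + b)%Z in
  [&& (0 <? b)%Z, (0 <=? lo)%Z, (sg * sg =? 1)%Z,
      pos_on01 (cell (scale_seq sg s)),
      pos_on01 (cell (lin_seq ((250 * b) ^ 2) (- lo ^ 2) s2 k2))
    & pos_on01 (cell (lin_seq (- (250 * b) ^ 2) (hi ^ 2) s2 k2))].

(** As [k] is [m] times the derivative of [c] and is positive on the cell, [m * c] increases there,
    which is why its sign change goes from negative to positive. The [quad_check]s follow the order
    of the equations in [reduced_system]. *)
Definition cert_ok (c : seq Z) (C : certificate) : bool :=
  let cell := on_cell (cert_cell C) (cert_base C) in
  let k := den_seq C c in
  let: Certificate m _ B nt nS nf nh ng := C in
  [&& [&& (0 <? B)%Z, (0 <=? cert_cell C)%Z, changes_sign (cell (scale_seq m c)), m != 0%Z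
        & pos_on01 (cell k)],
      [&& near_check cell k 1 99 100 nt, near_check cell k 1 7 100 nS,
          near_check cell k (-1) 6 100 nf, near_check cell k 1 15 26 nh
        & near_check cell k (-1) 84 100 ng]
    & [&& quad_check c k 1 3 1 nt nS, quad_check c k 1 3 1 nf nh,
          quad_check c k 1 3 1 (lin_seq 3 (-1) nS nf) (lin_seq 1 (-1) (lin_seq 2 1 nS nt) nh),
          quad_check c k 12 1 12 (lin_seq 1 (-1) nf ng)
            (lin_seq 1 (-4) (lin_seq 3 (-1) nh nf) nt)
        & quad_check c k 3 1 48 (lin_seq 1 (-2) (lin_seq 1 9 nt nS) ng)
            (lin_seq 1 (-1) (lin_seq 9 5 nS nt) (lin_seq 1 3 nf nh))]].

Definition coordinate (R : fieldType) (k : seq Z) (x : R) (s : seq Z) : R :=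
  x * ev s (x ^+ 2) / ev k (x ^+ 2).

Lemma coordinate_lin (R : fieldType) k (x : R) a b s t :
  coordinate k x (lin_seq a b s t) =
  zr R a * coordinate k x s + zr R b * coordinate k x t.
Proof. by rewrite /coordinate ev_lin; ring. Qed.

Lemma coordinate_quad (R : fieldType) c k (x : R) a b d s t :
  ev c (x ^+ 2) = 0 -> ev k (x ^+ 2) != 0 -> quad_check c k a b d s t ->
  zr R a * coordinate k x s ^+ 2 + zr R b * coordinate k x t ^+ 2 = zr R d.
Proof.
move=> cx k0; have {}cx : ev (head 0%Z c :: behead c) (x ^+ 2) = 0.
  by case: c cx => //= _; rewrite mulr0 addr0.
move/(ev_dvd_low cx); rewrite ev_lin ev_mul [ev (_ :: _) _]/= ev_lin !ev_mul zr0 zr1 zrN.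
rewrite /coordinate; move: (ev s _) (ev t _) (ev k _) k0 => u v w w0 e.
apply/eqP; rewrite -subr_eq0.
have -> : zr R a * (x * u / w) ^+ 2 + zr R b * (x * v / w) ^+ 2 - zr R d
  = (x ^+ 2 * (zr R a * u ^+ 2 + zr R b * v ^+ 2) - zr R d * w ^+ 2) / w ^+ 2.
  by field.
by rewrite [X in X / _](_ : _ = 0) ?mul0r // -e; ring.
Qed.

Lemma coordinate_near (R : realFieldType) A B k sg a b s (x y : R) :
  0 < zr R B -> 0 <= y <= 1 -> 0 < x -> x ^+ 2 = (zr R A + y) / zr R B ->
  0 < ev k (x ^+ 2) -> near_check (on_cell A B) k sg a b s ->
  near (zr R sg * (zr R a / zr R b)) (coordinate k x s).
Proof.
move=> B0 y01 x0 x2 k0 /and5P [b0 lo0 /Z.eqb_eq sg2 s0 /andP [lo hi]].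
have {}s0 := pos_on_cell B0 y01 s0; have {}lo := pos_on_cell B0 y01 lo.
have {}hi := pos_on_cell B0 y01 hi.
rewrite -x2 ev_scale in s0; rewrite -x2 ev_lin [ev (_ :: _) _]/= !ev_mul zr0 add0r in lo.
rewrite -x2 ev_lin [ev (_ :: _) _]/= !ev_mul zr0 add0r in hi.
rewrite /coordinate; move: (ev s _) (ev k _) k0 s0 lo hi => n w w0 n0.
rewrite !Z.pow_2_r !zrN !zrM zrB zrD !zrM (_ : zr R 250 = 250) // => lo hi.
have {}b0 : 0 < zr R b by rewrite -(zr0 R) zr_lt.
have sgR : zr R sg * zr R sg = 1 by rewrite -zrM sg2 zr1.
have : 0 <= zr R (250 * a - b) by rewrite -(zr0 R) zr_le.
rewrite zrB zrM (_ : zr R 250 = 250) //.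
move: (zr R b) (zr R a) (zr R sg) sgR b0 n0 lo hi.
move=> {a b sg sg2 lo0} b a sg sg2 b0 n0 lo hi lo0.
have u0 : 0 < sg * (x * n) by rewrite mulrCA mulr_gt0.
(* Since [sg] squares to 1, [u] is the absolute value of [x * n]. *)
set u := sg * (x * n) in u0.
have def_n : x * n = sg * u by rewrite /u mulrA sg2 mul1r.
have u2 : u ^+ 2 = x ^+ 2 * (n * n).
  by rewrite /u !exprMn [sg ^+ 2]expr2 sg2 mul1r -expr2.
rewrite -u2 in lo hi.
have ltu : (250 * a - b) * w < 250 * b * u.
  rewrite -(@ltr_pXn2r _ 2) ?nnegrE //; last 2 first.
  - by rewrite mulr_ge0 // ltW.
  - by rewrite ltW // mulr_gt0 // mulr_gt0.
  by rewrite -subr_gt0; move: lo; congr (0 < _); ring.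
have gtu : 250 * b * u < (250 * a + b) * w.
  rewrite -(@ltr_pXn2r _ 2) ?nnegrE //; last 2 first.
  - by rewrite ltW // mulr_gt0 // mulr_gt0.
  - by rewrite mulr_ge0 // ?(ltW w0) //; move: lo0 b0; clear; lra.
  by rewrite -subr_gt0; move: hi; congr (0 < _); ring.
rewrite /near def_n -mulrA -mulrBr normrM.
have -> : `|sg| = 1.
  by apply/eqP; rewrite -(@eqrXn2 _ 2) ?normr_ge0 // real_normK ?num_real // expr2 sg2 expr1n.
rewrite [X in X <= _]mul1r ler_norml.
have wb : 0 < 250 * (b * w) by rewrite !mulr_gt0.
have -> : u / w - a / b = (250 * b * u - 250 * a * w) / (250 * (b * w)).
  by field; rewrite (gt_eqF b0) (gt_eqF w0).
rewrite ler_pdivlMr // ler_pdivrMr //.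
have -> : - (1 / 250) * (250 * (b * w)) = - (b * w) by field.
have -> : 1 / 250 * (250 * (b * w)) = b * w by field.
by move: ltu gtu; clear; lra.
Qed.

Lemma cert_solution (R : rcfType) c C :
  cert_ok c C ->
  let k := den_seq C c in
  exists x : R,
    [/\ ev c (x ^+ 2) = 0, ev k (x ^+ 2) != 0,
        reduced_system (coordinate k x (num_t C)) (coordinate k x (num_S C))
          (coordinate k x (num_f C)) (coordinate k x (num_h C)) (coordinate k x (num_g C))
      & near_root (coordinate k x (num_t C)) (coordinate k x (num_S C))
          (coordinate k x (num_f C)) (coordinate k x (num_h C)) (coordinate k x (num_g C))].
Proof.
case: C => m a B nt nS nf nh ng; rewrite /cert_ok.
set k := den_seq _ c; cbn [cert_scale cert_cell cert_base num_t num_S num_f num_h num_g].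
case/and3P => /and5P [B0 a0 sgn m0 kpos] /and5P [bt bS bf bh bg] /and5P [q1 q2 q3 q4 q5].
have {}B0 : 0 < zr R B by rewrite -(zr0 R) zr_lt.
have [y y01 cy] := root_on_cell B0 sgn.
set w := (_ / _) in cy; have k0 := pos_on_cell B0 y01 kpos; rewrite -/w in k0.
have w0 : 0 <= w.
  rewrite divr_ge0 ?(ltW B0) // addr_ge0 //; last by case/andP: y01.
  by rewrite -(zr0 R) zr_le.
have mR : zr R m != 0 by rewrite intr_eq0; apply: contra_neq m0 => e; rewrite -[m]int_of_ZK e.
have {}cy : ev c w = 0.
  by move/eqP: cy; rewrite ev_scale mulf_eq0 (negPf mR) => /eqP.
have w_gt0 : 0 < w.
  (* At [w = 0] the lower bound check for [t] would make minus a product of squares positive. *)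
  rewrite lt0r w0 andbT; apply: contraTneq bt => w00.
  apply/negP => /and5P [_ _ _ _ /andP [lo _]]; have := pos_on_cell B0 y01 lo.
  rewrite -/w w00 ev_lin [ev (_ :: _) _]/= !ev_mul zr0 mul0r addr0 mulr0 add0r.
  rewrite zrN Z.pow_2_r zrM mulNr oppr_gt0 ltNge; case/negP.
  by rewrite mulr_ge0 // -expr2 sqr_ge0.
exists (Num.sqrt w); rewrite sqr_sqrtr //.
have x0 : 0 < Num.sqrt w by rewrite sqrtr_gt0.
have x2 : Num.sqrt w ^+ 2 = w by rewrite sqr_sqrtr.
have near_coord := coordinate_near B0 y01 x0 x2.
have quad_coord := @coordinate_quad R c k (Num.sqrt w).
move: near_coord quad_coord; rewrite x2 => near_coord /(_ _ _ _ _ _ cy) quad_coord.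
have k_neq0 : ev k w != 0 by rewrite gt_eqF.
split=> [//|//||].
  have := quad_coord _ _ _ _ _ k_neq0 q1; have := quad_coord _ _ _ _ _ k_neq0 q2.
  have := quad_coord _ _ _ _ _ k_neq0 q3; have := quad_coord _ _ _ _ _ k_neq0 q4.
  have := quad_coord _ _ _ _ _ k_neq0 q5; rewrite !coordinate_lin.
  rewrite !(zrN _ 1) !zr1 (_ : zr R 3 = 3) // => e5 e4 e3 e2 e1.
  split.
  - by rewrite -[RHS]e1; ring.
  - by rewrite -[RHS]e2; ring.
  - by rewrite -[RHS]e3; ring.
  - by rewrite -[RHS]e4; ring.
  - by rewrite -[RHS]e5; ring.
have := near_coord _ _ _ _ _ k0 bt; have := near_coord _ _ _ _ _ k0 bS.
have := near_coord _ _ _ _ _ k0 bf; have := near_coord _ _ _ _ _ k0 bh.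
have := near_coord _ _ _ _ _ k0 bg; rewrite !(zrN _ 1) !zr1 !mulN1r !mul1r.
by split.
Qed.

(** Four times a centred abscissa is [p * t + q * S + r * f - 3 * h - 2 * g]. If the numerators
    combine to [4 * k], the abscissa is exactly the root [x] that generates the field. *)
Definition axis_check (c : seq Z) (C : certificate) (p q r : Z) : bool :=
  all (Z.eqb 0)
    (lin_seq 1 (-4)
       (lin_seq 1 1 (lin_seq p q (num_t C) (num_S C))
          (lin_seq r (-1) (num_f C) (lin_seq 3 2 (num_h C) (num_g C))))
       (den_seq C c)).

Lemma cert_root (R : rcfType) c C p q r (t S f h g x : R) :
  reduced_system t S f h g -> near_root t S f h g ->
  cert_ok c C -> axis_check c C p q r ->
  4 * x = zr R p * t + zr R q * S + zr R r * f - 3 * h - 2 * g ->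
  root (map_poly intr (poly_in_X2 c)) x.
Proof.
move=> sys near /(@cert_solution R) [y [cy k0 sys' near']] axis.
have [-> -> -> -> ->] := reduced_system_uniq sys near sys' near'.
move: axis => /(ev_all0 (y ^+ 2)) axis def_x.
suff -> : x = y by rewrite /root ev_root_X2 cy.
apply: (@mulfI _ 4); first by rewrite pnatr_eq0.
rewrite def_x; move: axis k0; rewrite /coordinate !ev_lin !(zrN _ 1) (zrN _ 4) !zr1.
rewrite (_ : zr R 2 = 2) // (_ : zr R 3 = 3) // (_ : zr R 4 = 4) //.
move: (ev (den_seq _ _) _) => k axis k0.
rewrite -[RHS](_ : y * (4 * k) / k = _); last by field.
have -> : 4 * k = zr R p * ev (num_t C) (y ^+ 2) + zr R q * ev (num_S C) (y ^+ 2)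
    + zr R r * ev (num_f C) (y ^+ 2) - 3 * ev (num_h C) (y ^+ 2) - 2 * ev (num_g C) (y ^+ 2).
  by apply/eqP; rewrite eq_sym -subr_eq0 -axis; apply/eqP; ring.
by ring.
Qed.

(** * Reduction of the Harborth system *)

(** Only coarse fractions are used below; comparing them with the decimals is an integer
    computation. *)
Lemma approx15_bounds (R : realType) (x : R) (n lo hi d : Z) :
  approx15 x n ->
  [&& (0 <? d)%Z, (lo * 10 ^ 15 <=? (n - 1) * d)%Z & ((n + 1) * d <=? hi * 10 ^ 15)%Z] ->
  zr R lo / zr R d < x < zr R hi / zr R d.
Proof.
rewrite /approx15 -/(zr R n) ltr_norml.
have p15 : 0 < 10 ^+ 15 :> R by rewrite exprn_gt0.
have zr15 a : zr R (a * 10 ^ 15) = zr R a * 10 ^+ 15.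
  by rewrite zrM -[(10 ^ 15)%Z]/(10 ^+ 15 : Z) /zr !rmorphXn.
move=> /andP [lon hin] /and3P [].
rewrite -!(zr_lt R) -!(zr_le R) !zr15 (zrM _ (n - 1)) (zrM _ (n + 1)) zrB zrD zr0 zr1.
move: (10 ^+ 15) p15 (zr R n) (zr R d) lon hin => {zr15} u u0 m e lon hin e0 lo_m m_hi.
rewrite ltr_pdivrMr // ltr_pdivlMr // -(ltr_pM2r u0) -[X in _ && X](ltr_pM2r u0).
have mx : (m - 1) * e < x * e * u.
  rewrite mulrAC ltr_pM2r // -subr_gt0; move: lon; rewrite -(ltr_pM2r u0).
  by rewrite mulNr mulrBl !divfK ?gt_eqF //; clear; lra.
have xm : x * e * u < (m + 1) * e.
  rewrite mulrAC ltr_pM2r // -subr_gt0; move: hin; rewrite -(ltr_pM2r u0).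
  by rewrite mulrBl !divfK ?gt_eqF //; clear; lra.
by rewrite (le_lt_trans lo_m mx) (lt_le_trans xm m_hi).
Qed.

(** By Lagrange's identity, the lengths and the inner product of two vectors determine their cross
    product up to sign. The sign of [k] selects the orientation, and the second vector follows
    linearly. *)
Lemma planar_coordinates (R : realFieldType) (p q u v n m d k : R) :
  p ^+ 2 + q ^+ 2 = n -> u ^+ 2 + v ^+ 2 = m -> p * u + q * v = d ->
  k ^+ 2 = n * m - d ^+ 2 -> 0 < k * (p * v - q * u) ->
  n * u = p * d - q * k /\ n * v = q * d + p * k.
Proof.
move=> en em ed ek pos.
have cross : (p * v - q * u) ^+ 2 = k ^+ 2 by rewrite ek -en -em -ed; ring.
have {cross} : p * v - q * u = k.
  move/eqP: cross; rewrite eqf_sqr => /orP [/eqP // | /eqP e].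
  by move: pos; rewrite e mulrN -expr2 oppr_gt0 ltNge sqr_ge0.
by move=> <-; rewrite -ed -en; split; ring.
Qed.

Lemma harborth_reduced (R : realType) (t T : R) (D E F G H J : R * R) :
  harborth_system t T D E F G H J -> harborth_approx t T D E F G H J ->
  let S := T / Num.sqrt 3 in
  let h := F.2 / Num.sqrt 3 in
  [/\ reduced_system t S F.1 h G.1, near_root t S F.1 h G.1,
      D.1 = t / 2 + 9 / 2 * S, E.1 = 3 * S
    & J.1 = (F.1 + 2 * G.1 + 3 * h - 4 * t) / 4].
Proof.
case: D E F G H J => [D1 D2] [E1 E2] [F1 F2] [G1 G2] [H1 H2] [J1 J2].
rewrite /harborth_system /harborth_approx /sqdist; cbn [fst snd].
move=> [tT [D_line [D_circ [E_line [E_circ [F_circ [EF [FG [DG [DH [GH [FJ [GJ HJ]]]]]]]]]]]]].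
move=> [at_ [aT [aD1 [aD2 [aE1 [aE2 [aF1 [aF2 [aG1 [aG2 [aH1 [aH2 [aJ1 aJ2]]]]]]]]]]]]].
set r := Num.sqrt 3; have r0 : 0 < r by rewrite sqrtr_gt0.
have r2 : r * r = 3 by rewrite -expr2 sqr_sqrtr.
(* The bounds in tenths decide orientations; the finer ones after them place the solution in the
   box. *)
have bt : 9 / 10 < t < 10 / 10 := @approx15_bounds R t _ 9 10 10 at_ isT.
have bT : 1 / 10 < T < 2 / 10 := @approx15_bounds R T _ 1 2 10 aT isT.
have bD1 : 8 / 10 < D1 < 9 / 10 := @approx15_bounds R D1 _ 8 9 10 aD1 isT.
have bD2 : 27 / 10 < D2 < 28 / 10 := @approx15_bounds R D2 _ 27 28 10 aD2 isT.
have bE1 : 2 / 10 < E1 < 3 / 10 := @approx15_bounds R E1 _ 2 3 10 aE1 isT.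
have bE2 : 19 / 10 < E2 < 20 / 10 := @approx15_bounds R E2 _ 19 20 10 aE2 isT.
have bF1 : - 1 / 10 < F1 < 0 / 10 := @approx15_bounds R F1 _ (-1) 0 10 aF1 isT.
have bF2 : 9 / 10 < F2 < 10 / 10 := @approx15_bounds R F2 _ 9 10 10 aF2 isT.
have bG1 : - 9 / 10 < G1 < - 8 / 10 := @approx15_bounds R G1 _ (-9) (-8) 10 aG1 isT.
have bG2 : 16 / 10 < G2 < 17 / 10 := @approx15_bounds R G2 _ 16 17 10 aG2 isT.
have bH1 : - 10 / 10 < H1 < - 9 / 10 := @approx15_bounds R H1 _ (-10) (-9) 10 aH1 isT.
have bH2 : 36 / 10 < H2 < 37 / 10 := @approx15_bounds R H2 _ 36 37 10 aH2 isT.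
have bJ1 : - 10 / 10 < J1 < - 9 / 10 := @approx15_bounds R J1 _ (-10) (-9) 10 aJ1 isT.
have bJ2 : 6 / 10 < J2 < 7 / 10 := @approx15_bounds R J2 _ 6 7 10 aJ2 isT.
have ct : 496 / 500 < t < 497 / 500 := @approx15_bounds R t _ 496 497 500 at_ isT.
have cT : 15 / 125 < T < 16 / 125 := @approx15_bounds R T _ 15 16 125 aT isT.
have cF1 : - 8 / 125 < F1 < - 7 / 125 := @approx15_bounds R F1 _ (-8) (-7) 125 aF1 isT.
have cF2 : 199 / 200 < F2 < 200 / 200 := @approx15_bounds R F2 _ 199 200 200 aF2 isT.
have cG1 : - 210 / 250 < G1 < - 209 / 250 := @approx15_bounds R G1 _ (-210) (-209) 250 aG1 isT.
clear at_ aT aD1 aD2 aE1 aE2 aF1 aF2 aG1 aG2 aH1 aH2 aJ1 aJ2.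
set S := T / r; set h := F2 / r.
have [defT defF2] : T = r * S /\ F2 = r * h.
  by rewrite /S /h; split; rewrite mulrC divfK ?gt_eqF.
clearbody S h.
have neg3 (a x : R) : 0 < a -> x < 0 -> 0 < - a * r * x.
  by move=> a0 x0; rewrite 2!mulNr oppr_gt0 pmulr_rlt0 // mulr_gt0.
have tT' : (- t) ^+ 2 + T ^+ 2 = 1 by rewrite sqrrN.
have tT'' : t ^+ 2 + (- T) ^+ 2 = 1 by rewrite sqrrN.
(* [D - C] has length 3 and lies at 60 degrees clockwise from the unit vector [B - C]. *)
have [D1E D2E] : D1 = t / 2 + 9 / 2 * S /\ D2 = r * (3 / 2 * (S + t)).
  have crossD : - t * D2 - T * (D1 - 2 * t) < 0.
    clear -bt bT bD1 bD2.
    have : 1 / 2 < t * D2 - 2 / 10 * t * 2 by nra.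
    have : T * D1 > 0 by apply: mulr_gt0; lra.
    have : T * t < 2 / 10 * t by nra.
    by nra.
  have [||eu ev] := planar_coordinates (k := - (3 / 2) * r) tT' D_circ D_line.
  - by rewrite exprMn [r ^+ 2]expr2 r2; field.
  - by apply: neg3; rewrite ?divr_gt0.
  have eu' : D1 = t / 2 + 3 / 2 * (r * T) by move: eu; clear; lra.
  rewrite eu' defT mulrA r2; split; first by field.
  by move: ev; rewrite defT mul1r => ->; field.
(* [E - B] has length 2 and lies at 120 degrees counterclockwise from the unit vector [C - B]. *)
have [E1E E2E] : E1 = 3 * S /\ E2 = r * (2 * S + t).
  have crossE : 0 < t * (E2 - T) - (- T) * (E1 - t).
    by clear -bt bT bE1 bE2; nra.
  have E_line' : t * (E1 - t) + (- T) * (E2 - T) = - 1 by move: E_line; clear; lra.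
  have [||eu ev] := planar_coordinates (k := r) tT'' E_circ E_line'.
  - by rewrite expr2 r2; field.
  - by rewrite mulr_gt0.
  have eu' : E1 = r * T by move: eu; clear; lra.
  rewrite eu' defT mulrA r2; split=> //.
  by move: ev; rewrite defT; clear; lra.
(* The distances leave two positions for the apex [H] of the equilateral triangle on DG; the bounds
   select a counterclockwise turn from [D - G] to [H - D]. For [J] the turn from [F - G] to [J - F]
   is clockwise. *)
have H1E : H1 = (D1 + G1) / 2 - r / 2 * (D2 - G2).
  have cross : 0 < (D1 - G1) * (H2 - D2) - (D2 - G2) * (H1 - D1).
    rewrite addr_gt0 //; first by clear -bD1 bG1 bD2 bH2; apply: mulr_gt0; lra.
    by rewrite -mulrN; clear -bD2 bG2 bH1 bD1; apply: mulr_gt0; lra.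
  have circ : (H1 - D1) ^+ 2 + (H2 - D2) ^+ 2 = 4 by rewrite -DH; ring.
  have line : (D1 - G1) * (H1 - D1) + (D2 - G2) * (H2 - D2) = - 2.
    by move: GH DG DH; clear; lra.
  have [||eu _] := planar_coordinates (k := 2 * r) DG circ line.
  - by rewrite exprMn [r ^+ 2]expr2 r2; ring.
  - by rewrite !mulr_gt0.
  by move: eu; clear; lra.
have J1E : J1 = (F1 + G1) / 2 + r / 2 * (F2 - G2).
  have cross : (F1 - G1) * (J2 - F2) - (F2 - G2) * (J1 - F1) < 0.
    rewrite -oppr_gt0 opprB addr_gt0 //; last first.
      by rewrite -mulrN; clear -bF1 bG1 bF2 bJ2; apply: mulr_gt0; lra.
    by rewrite -mulrNN; clear -bF2 bG2 bF1 bJ1; apply: mulr_gt0; lra.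
  have circ : (J1 - F1) ^+ 2 + (J2 - F2) ^+ 2 = 1 by rewrite -FJ; ring.
  have line : (F1 - G1) * (J1 - F1) + (F2 - G2) * (J2 - F2) = - (1 / 2).
    by move: GJ FG FJ; clear; lra.
  have [||eu _] := planar_coordinates (k := - (1 / 2) * r) FG circ line.
  - by rewrite exprMn [r ^+ 2]expr2 r2; field.
  - by apply: neg3; rewrite ?divr_gt0.
  by move: eu; clear; lra.
(* Equating the abscissae of [H] and [J] cancels [G1] and leaves a linear equation for [r * G2]. *)
have G2E : G2 = r * ((F1 + 3 * h + 4 * t) / 6).
  have e : 6 * G2 = 2 * r * (r * G2) by rewrite -mulrA [r * (r * _)]mulrA r2; ring.
  have rD2 : r * D2 = 3 * (3 / 2 * (S + t)) by rewrite D2E mulrA r2.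
  have rF2 : r * F2 = 3 * h by rewrite defF2 mulrA r2.
  have f : 2 * (r * G2) = F1 + 3 * h + 4 * t.
    have := HJ; rewrite H1E J1E; move: rD2 rF2 D1E; clear; lra.
  by rewrite mulrA -f; rewrite -[LHS](mulfK (x := 6)) ?pnatr_eq0 // [G2 * 6]mulrC e; field.
have rsq x : (r * x) ^+ 2 = 3 * x ^+ 2 by rewrite exprMn [r ^+ 2]expr2 r2.
split.
- split.
  + by rewrite -rsq -defT.
  + by rewrite -rsq -defF2.
  + by rewrite -rsq mulrBr -E2E -defF2 -E1E.
  + have := FG; rewrite defF2 G2E -mulrBr rsq => /(congr1 ( *%R 12)).
    by rewrite mulr1 => e; rewrite -[RHS]e; field.
  + have := DG; rewrite D1E D2E G2E -mulrBr rsq => /(congr1 ( *%R 12)).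
    by rewrite -natrM => e; rewrite -[RHS]e; field.
(* Rational bounds on [sqrt 3] convert the bounds on [T] and [F2] into bounds on [S] and [h]. *)
- have r_lo : 173 / 100 < r.
    by rewrite -(@ltr_pXn2r _ 2) ?nnegrE ?(ltW r0) // ?expr2 ?r2; clear; lra.
  have r_hi : r < 347 / 200.
    by rewrite -(@ltr_pXn2r _ 2) ?nnegrE ?(ltW r0) // ?expr2 ?r2; clear; lra.
  have S_r := esym defT; have h_r := esym defF2.
  split; rewrite /near ler_norml.
  + by move: ct; clear; lra.
  + by clear -r_lo r_hi S_r cT; nra.
  + by move: cF1; clear; lra.
  + by clear -r_lo r_hi h_r cF2; nra.
  + by move: cG1; clear; lra.
- exact: D1E.
- exact: E1E.
have rF2 : r * F2 = 3 * h by rewrite defF2 mulrA r2.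
have rG2 : r * G2 = (F1 + 3 * h + 4 * t) / 2 by rewrite G2E mulrA r2; field.
by rewrite J1E; move: rF2 rG2; clear; lra.
Qed.

(** * The certificates *)

Definition cert_B : certificate :=
  Certificate (-1627233) 2022 512
    [:: -106858809285804493359417; 532338203524438895843277; -515329957173997876075344;
        159686843734871697309120; -17295700803128161748736; 1273114647383220617216;
        -372698755623985242112; 70639672343897931776; -6413039445156823040;
        278614206217977856; -4802418160173056]%Z
    [:: 60525079447649991755463; -235865108215110773643723; 234804139097978082102264;
        -80290575643460045357952; 12870274264073852117760; -1661894570246404485120;
        266761882387332661248; -34411930721534115840; 2643058786269659136;
        -105423748171038720; 1729826666840064]%Z
    [:: 104624022852291445066026; -186824845511626891302486; 190691582494272098900796;
        -81175552723163289797856; 17295162775034179743744; -2857465868141476551680;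
        534946053450779668480; -78136431207305019392; 6639045783193124864;
        -289304660961918976; 5000124610641920]%Z
    [:: -96365969237152964557440; 416952693078327300950388; -352043229423127254878124;
        89350441054080499216800; -4589046954890522939904; -236064150932557106176;
        -130888350408145334272; 34462628154395033600; -3221215111087652864;
        133297831640301568; -2042172765372416]%Z
    [:: -55487302470533167495677; 471504642030327481121421; -403991136220613152023108;
        84984354615202154793216; 684548084679561158400; -1638699755933482487808;
        197235058768397512704; -17884621964269092864; 1474165117280845824;
        -71246416120381440; 1323795713359872]%Z.

Definition cert_C : certificate :=
  Certificate (-2973700644) 9096 1024
    [:: -103783809158670223121690405565; 118298854347400283291003882130;
        -50315409153501188864288921418; 10610913730112581461686009772;
        -1362558570085560117724029012; 128972860300696222499947296;
        -9840402158980321614372672; 564704728946079014888448; -21392864984429541175296;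
        461439078161041784832; -4287178788990418944]%Z
    [:: 48768769766518102694220847125; -56508518587531765270634802866;
        24825313542004418771763231306; -5479108239156390055882530492;
        731535740358376371105929364; -67327880143764269649590304; 4577297043542267709800256;
        -227279898154133090669568; 7620264417223320416256; -150746283519154913280;
        1323891055463825408]%Z
    [:: 51771335311687557131568944145; -67211000938762322971579781262;
        35213892981997123576723589562; -9565178099948203942980047868;
        1535424817929315988674187812; -162902324744866572146822688;
        12389818345555445956964928; -679266424517049693127680; 24907367999195999662080;
        -531132535388577398784; 4886530727196819456]%Z
    [:: -60118149559602543809913861735; 63129066084089882758726037530;
        -23854295726476649626062120678; 4257628682788906713162062388;
        -462249310333955779386898716; 42409620761102333345534688;
        -3614810673472949627780544; 228548762146594552949760; -8874151469679574093824;
        182692306421852602368; -1508725595557003264]%Z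
    [:: -60892457898788954599726348020; 54759459358050557152484083500;
        -13037366722624505187212009040; -355722301517562548398826952;
        455324761431986649017520576; -66577495273992085276438656; 5280812235814009814773248;
        -281619830346407960856576; 10184579944113554817024; -218529540323233824768;
        2038112771317432320]%Z.

Definition cert_D : certificate :=
  Certificate (-7984374) 53382 16384
    [:: -8167468610873396709; 61780666482185919378; -174387886659257631825;
        247726582149566888952; -202702012427795645856; 102145568635498566912;
        -32660672475982632960; 6672596659042836480; -862237995850039296; 67693836002131968;
        -2663508165525504]%Z
    [:: -58892155762780399935; 217368088848509283790; -349847235250322733867;
        322504225680394764744; -188071143577548469728; 72233643804720264960;
        -18438998364510873600; 3088011853921001472; -328307205270503424; 20837550420393984;
        -656831750864896]%Z
    [:: 169281193319753737671; -723333474195754283106; 1330037637164420143647;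
        -1384189927437995853144; 902737869731532121440; -386235633454023978240;
        110318481310949087232; -20965963095808253952; 2579639393813495808;
        -190467173024268288; 6627038453563392]%Z
    [:: -15646522260685341; 42031328403391540414; -155300398095270620157;
        238523893414437690696; -199614571784478734112; 99926505470841477888;
        -30824640358899247104; 5801525466039214080; -634816910174355456; 36607604978614272;
        -915913021849600]%Z
    [:: 465403538259438492006; -1826577638369136211680; 3110389322150298764298;
        -3010567745026589584848; 1826720850477151155648; -724477789261042473984;
        190473908915521486848; -33064307706542751744; 3710802228001701888;
        -254617835543199744; 8655464407498752]%Z.

Definition cert_E : certificate :=
  Certificate (-2274) 5939 4096
    [:: 88876527130301940; -204958023007069683; -123065110787831244; 895539046917954240;
        -1338302110655061504; 1083419569177684992; -548780882168401920; 177749126122045440;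
        -35075726321909760; 3799800817385472; -205745119297536]%Z
    [:: -38082627080265420; 89972700556392477; -117760424798400444; 198060719183237952;
        -278352168058814976; 231850612229385216; -115891487623254016; 36292997202313216;
        -6839857036394496; 658367344279552; -29384350105600]%Z
    [:: 206291882243498040; -1521565935218678322; 4195037752799386608; -6309389984504228928;
        6004681283547721728; -3862172479043764224; 1705538151066599424; -505201708552617984;
        94636235166842880; -10112864272515072; 505137479024640]%Z
    [:: 104206230952136640; -428789491028749296; 570715828102910952; -161293055399347392;
        -343048932074769408; 448854457604265984; -270720084728766464; 95769924978409472;
        -19096526725840896; 1762066574606336; -57128643461120]%Z
    [:: 528789737867326020; -2955904701076771263; 7018984815210939996; -9691555925364460992;
        8793870388537618944; -5499790342812877824; 2378582767715291136; -689293977954287616;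
        124667739360460800; -12513592294244352; 612807204667392]%Z.

Definition cert_F : certificate :=
  Certificate (-789) 57128 65536
    [:: 50820247188; -910249061952; -1691367986496; 80220133390848; -138355457636352;
        -499501522550784; 4059560307720192; -5735798066380800; 1586226278694912;
        535253470937088; 40153179488256]%Z
    [:: -20729393364; 87135889408; 3085483978560; -16051300929024; -16004663101440;
        251135300665344; -543880530493440; 421127236091904; -77687357964288;
        -17392553951232; -1125885411328]%Z
    [:: -74561780484; 887132950752; 6748833062208; -52768623657984; -201698468947968;
        1524281289424896; -3658189985415168; 3241838197604352; -494846676566016;
        -286038127804416; -33428468662272]%Z
    [:: 26125915884; -692371834400; 150966868032; 68268284439552; -159080021207040;
        -590162669420544; 4602795953356800; -6722894306476032; 1947499361206272;
        798779007565824; 61263212183552]%Z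
    [:: -17786430648; 74458255680; 4860616941696; 27455728880640; -381774050451456;
        1138756682366976; 3561309119447040; -10571666790285312; 5010022408912896;
        1412980084310016; 93197300662272]%Z.

(** * Minimal polynomials of the five centred abscissae *)

Lemma is_minpoly_poly_in_X2 (R : realType) p c C a b d (t S f h g x : R) :
  prime p -> irreducible_mod p c ->
  reduced_system t S f h g -> near_root t S f h g ->
  cert_ok c C -> axis_check c C a b d ->
  4 * x = zr R a * t + zr R b * S + zr R d * f - 3 * h - 2 * g ->
  algebraicOver (ratr : rat -> R) x /\ is_minpoly (poly_in_X2 c) x.
Proof.
move=> p_pr irr sys near ok axis def_x.
have irrQ := irreducible_poly_in_X2 p_pr irr.
have rootP := cert_root sys near ok axis def_x.
split; last by split.
exists (map_poly intr (poly_in_X2 c)).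
  by case: irrQ => sz _; rewrite -size_poly_gt0; apply: ltn_trans sz.
rewrite -map_poly_comp (eq_map_poly (g := intr)) // => z.
by rewrite /= ratr_int.
Qed.

Theorem mainTheorem9 (R : realType) (t T : R) (D E F G H J : R * R)
    (hsys : harborth_system t T D E F G H J)
    (happrox : harborth_approx t T D E F G H J) :
  let B : R * R := (t, T) in
  let C : R * R := (2 * t, 0) in
  (algebraicOver (ratr : rat -> R) (x_centred J B) /\
   is_minpoly P_xB (x_centred J B)) /\
  (algebraicOver (ratr : rat -> R) (x_centred J C) /\
   is_minpoly P_xC (x_centred J C)) /\
  (algebraicOver (ratr : rat -> R) (x_centred J D) /\
   is_minpoly P_xD (x_centred J D)) /\
  (algebraicOver (ratr : rat -> R) (x_centred J E) /\
   is_minpoly P_xE (x_centred J E)) /\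
  (algebraicOver (ratr : rat -> R) (x_centred J F) /\
   is_minpoly P_xF (x_centred J F)).
Proof.
have := harborth_reduced hsys happrox; cbv zeta.
move: (T / _) (F.2 / _) => S h [sys near D1 E1 J1].
rewrite /x_centred D1 E1 J1 /P_xB /P_xC /P_xD /P_xE /P_xF; cbn [fst].
split; [|split; [|split; [|split]]].
(* In each case the three integers are the coefficients of [t], [S] and [f] in four times the
   centred abscissa, after substituting the formula for [J.1]. *)
- refine (@is_minpoly_poly_in_X2 R 17 _ cert_B 8 0 (-1) _ _ _ _ _ _ _ _ sys near _ _ _).
  + by [].
  + by vm_compute.
  + by vm_compute.
  + by vm_compute.
  + by rewrite -[zr R 8]/(8 : R) -[zr R 0]/(0 : R) -[zr R (-1)]/(- 1 : R); field.
- refine (@is_minpoly_poly_in_X2 R 17 _ cert_C 12 0 (-1) _ _ _ _ _ _ _ _ sys near _ _ _).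
  + by [].
  + by vm_compute.
  + by vm_compute.
  + by vm_compute.
  + by rewrite -[zr R 12]/(12 : R) -[zr R 0]/(0 : R) -[zr R (-1)]/(- 1 : R); field.
- refine (@is_minpoly_poly_in_X2 R 17 _ cert_D 6 18 (-1) _ _ _ _ _ _ _ _ sys near _ _ _).
  + by [].
  + by vm_compute.
  + by vm_compute.
  + by vm_compute.
  + by rewrite -[zr R 6]/(6 : R) -[zr R 18]/(18 : R) -[zr R (-1)]/(- 1 : R); field.
- refine (@is_minpoly_poly_in_X2 R 17 _ cert_E 4 12 (-1) _ _ _ _ _ _ _ _ sys near _ _ _).
  + by [].
  + by vm_compute.
  + by vm_compute.
  + by vm_compute.
  + by rewrite -[zr R 4]/(4 : R) -[zr R 12]/(12 : R) -[zr R (-1)]/(- 1 : R); field.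
- refine (@is_minpoly_poly_in_X2 R 17 _ cert_F 4 0 3 _ _ _ _ _ _ _ _ sys near _ _ _).
  + by [].
  + by vm_compute.
  + by vm_compute.
  + by vm_compute.
  + by rewrite -[zr R 4]/(4 : R) -[zr R 0]/(0 : R) -[zr R 3]/(3 : R); field.
Qed.
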